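(* Let $0<a<b<\infty$, $\alpha>0$ and $\rho>0$ be real numbers. Let $u,v:[a,b]\to\mathbb{R}$ be two integrable functions and $g:[a,b]\to\mathbb{R}$ a continuous function. Assume that $u$ and $v$ are nonnegative, and that $g$ is nonnegative and nondecreasing. If $$u(t)\leq v(t)+g(t)\rho^{1-\alpha}\int_a^t\tau^{\rho-1}(t^\rho-\tau^\rho)^{\alpha-1}u(\tau)\,d\tau, \quad \forall t\in[a,b],$$ then $$u(t)\leq v(t)+\int_a^t\sum_{k=1}^\infty\frac{\rho^{1-k\alpha}(g(t)\Gamma(\alpha))^k}{\Gamma(k\alpha)}\tau^{\rho-1}(t^\rho-\tau^\rho)^{k\alpha-1}v(\tau)\,d\tau, \quad \forall t\in[a,b].$$ In addition, if $v$ is nondecreasing, then $$u(t)\leq v(t)E_\alpha\left[g(t)\Gamma(\alpha)\left(\frac{t^\rho-a^\rho}{\rho}\right)^\alpha\right], \quad \forall t\in[a,b].$$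
   Context: $\Gamma$ denotes the Gamma function, and $E_\alpha(t)=\sum_{k=0}^\infty \frac{t^k}{\Gamma(\alpha k+1)}$, $t\in\mathbb{R}$, is the Mittag-Leffler function. Integrals of nonnegative functions are understood as Lebesgue integrals with values in $[0,+\infty]$. *)

(* Defs.v *)
From HB Require Import structures.
From mathcomp Require Import all_boot all_order all_algebra.
From mathcomp Require Import all_classical all_reals all_analysis.

Set Implicit Arguments.
Unset Strict Implicit.
Unset Printing Implicit Defensive.
Import Order.TTheory GRing.Theory Num.Theory.
Import numFieldNormedType.Exports.

Local Open Scope classical_set_scope.
Local Open Scope ring_scope.

(* Euler's integral, which converges exactly for x > 0; only such arguments
   are meaningful. *)
Definition Gamma {R : realType} (x : R) : R :=
  \int[lebesgue_measure]_(s in `]0, +oo[) (s `^ (x - 1) * expR (- s)).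

Definition mittag_leffler {R : realType} (alpha t : R) : R :=
  limn (series (fun k : nat => t ^+ k / Gamma (alpha * k%:R + 1))).

(* Integrability and integrals on the real line refer to the completed Lebesgue
   measure, whose sigma-algebra consists of all Lebesgue measurable sets;
   [lebesgue_measure] would restrict to Borel functions.
   A kernel (t^rho - s^rho)^(alpha - 1) with alpha < 1 gets the junk value 0 at
   its singularity s = t ([powR] at base 0), which is harmless: {t} is null. *)
Definition Lintegrable {R : realType} (D : set R) (f : R -> R) : Prop :=
  (@completed_lebesgue_measure R).-integrable D (EFin \o f).

Definition Lintegral {R : realType} (D : set R) (f : R -> \bar R) : \bar R :=
  (\int[@completed_lebesgue_measure R]_(s in D) f s)%E.

(* Main.v *)
Require Import Defs.
From HB Require Import structures.
From mathcomp Require Import all_boot all_order all_algebra.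
From mathcomp Require Import all_classical all_reals all_analysis.
From mathcomp Require Import measurable_realfun.
From mathcomp Require Import ring lra.

(** Write [J beta phi t] for the Katugampola fractional integral
    rho^(1-beta) / Gamma(beta) *
      int_a^t r^(rho-1) (t^rho - r^rho)^(beta-1) phi(r) dr,
    and put G = Gamma(alpha) g, so that the hypothesis is
    u <= v + G * J alpha u.  Two facts drive the proof.

    - Semigroup property: J beta (J alpha phi) <= J (beta + alpha) phi.  By
      Tonelli it is a statement about kernels, and after the change of variables
      w = (r^rho - s^rho) / (t^rho - r^rho) it becomes Euler's identity
      Gamma(x) Gamma(y) =
        Gamma(x+y) * int_0^oo w^(y-1) (1+w)^(-x-y) dw
      ([Gamma_mul_integral], [power_kernel_integral],
      [katugampola_integral_comp_le]).
    - Since g is nondecreasing, G(r) <= G(t) for r <= t, so applying J beta to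
      the hypothesis gives J beta u <= J beta v + G * J (beta + alpha) u with
      the factor G evaluated at the outer point t
      ([katugampola_integral_gronwall_step]).

    Iterating along beta = alpha, 2 alpha, ... yields, at every t,
    u <= v + sum_(1 <= k <= n) G^k J (k alpha) v + G^(n+1) J ((n+1) alpha) u.
    As soon as n alpha >= 1 the kernel is bounded, so the last term is at most
    a constant times c^n / Gamma(n alpha), which tends to 0 because Gamma
    outgrows every geometric sequence ([Gamma_growth],
    [katugampola_integral_remainder]).  The first conclusion follows by summing
    under the integral.  When v is nondecreasing, v(r) <= v(t) under the
    integral and J beta 1 = ((t^rho - a^rho) / rho)^beta / Gamma(beta + 1)
    turns the sum into v(t) times a partial sum of the Mittag-Leffler series.

    The functions u and v are only measurable for the completed sigma-algebra,
    whereas changes of variables live on Borel functions.  The operators J are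
    therefore defined on an abstract sigma-finite space T with a map X to the
    reals along which the measure of T becomes Lebesgue measure; Tonelli is
    used on T * T, and kernel integrals are computed after transport by X. *)

Set Implicit Arguments.
Unset Strict Implicit.
Unset Printing Implicit Defensive.
Import Order.TTheory GRing.Theory Num.Theory.
Import numFieldNormedType.Exports.

Local Open Scope classical_set_scope.
Local Open Scope ring_scope.

(** * Substitution in integrals singular at the end points *)

Definition segment_exhaustible (R : realType) (A : set R) : Prop :=
  exists p q : R^nat, [/\ nonincreasing_seq p, nondecreasing_seq q,
    (forall n, p n <= q n) & A = \bigcup_n [set` `[p n, q n]]].

(** The integrands below are singular at the ends of their domain.  On each
    segment [p n, q n] of an exhaustion the integrand is continuous up to the
    boundary and the classical substitution rule applies; monotone convergence
    passes to the limit. *)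
Lemma ge0_integration_by_substitution_exhaustion (R : realType)
    (F f G : R -> R) (A B : set R) :
  open A -> segment_exhaustible A ->
  (forall x, A x -> is_derive x 1 F (f x)) ->
  (forall x, A x -> 0 < f x) ->
  (forall x, A x -> {for x, continuous f}) ->
  (forall x, A x -> B (F x)) ->
  (forall y, B y -> exists2 x, A x & F x = y) ->
  (forall y, B y -> {for y, continuous G}) ->
  (forall y, B y -> 0 <= G y) ->
  (\int[lebesgue_measure]_(y in B) (G y)%:E =
   \int[lebesgue_measure]_(x in A) (G (F x) * f x)%:E)%E.
Proof.
move=> oA [p [q [dp iq pq AE]]] dF f0 cf FB FB' cG G0.
have pqA n x : p n <= x <= q n -> A x.
  by move=> h; rewrite AE; exists n => //=; rewrite in_itv.
have F'E x : A x -> derive1 F x = f x.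
  by move=> /dF dFx; rewrite derive1E; exact: derive_val.
have cF x : A x -> {for x, continuous F}.
  by move=> /dF[dFx _]; apply/differentiable_continuous/derivable1_diffP.
have cF' x : A x -> {for x, continuous (derive1 F)}.
  move=> Ax; suff : derive1 F z @[z --> x] --> f x by rewrite -(F'E _ Ax).
  apply: (@cvg_trans _ (f @ x)); last exact: cf.
  apply: near_eq_cvg; near=> z; apply/esym/F'E; near: z.
  exact: (open_nbhs_nbhs (conj oA Ax)).
have Flt n : {in `[p n, q n] &, {homo F : x y / x < y}}.
  apply: gtr0_derive1_lt_cc.
  - move=> x; rewrite in_itv/= => /andP[px xq].
    by have [] : is_derive x 1 F (f x) by apply: dF; apply: (pqA n); rewrite !ltW.
  - move=> x; rewrite in_itv/= => /andP[px xq].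
    have Ax : A x by apply: (pqA n); rewrite !ltW.
    by rewrite F'E// f0.
  - apply: continuous_in_subspaceT => x; rewrite inE/= in_itv/= => /pqA.
    exact: cF.
have Fle n x y : p n <= x -> y <= q n -> x <= y -> F x <= F y.
  move=> px yq; rewrite le_eqVlt => /predU1P[->//|xy].
  by apply/ltW/(Flt n) => //; rewrite in_itv/= ?px ?yq ?andbT ?(le_trans px)//
    ?ltW// (lt_le_trans xy).
have pA n : A (p n) by apply: (pqA n); rewrite lexx pq.
have qA n : A (q n) by apply: (pqA n); rewrite lexx pq.
have BE : B = \bigcup_n [set` `[F (p n), F (q n)]].
  apply/seteqP; split => [y /FB'[x Ax <-]|y [n _]]/=.
    move: (Ax); rewrite AE => -[n _] /=; rewrite in_itv/= => /andP[px xq].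
    by exists n => //=; rewrite in_itv/= !(Fle n).
  move=> yF.
  have [x] : exists2 x, x \in `[p n, q n] & F x = y.
    apply: IVT => //.
      apply: continuous_in_subspaceT => x; rewrite inE/= in_itv/= => /pqA.
      exact: cF.
    by rewrite min_l ?max_r//; apply: (Fle n).
  by rewrite in_itv/= => /pqA Ax <-; exact: FB.
have fE n : (\int[lebesgue_measure]_(y in `[F (p n), F (q n)]) (G y)%:E =
    \int[lebesgue_measure]_(x in `[p n, q n]) (G (F x) * f x)%:E)%E.
  rewrite integration_by_substitution_increasing//.
  - apply: eq_integral => x; rewrite inE/= in_itv/= => /pqA Ax.
    by rewrite !fctE F'E.
  - move=> x; rewrite in_itv/= => /andP[px xq]; apply: cF'.
    by apply: (pqA n); rewrite !ltW.
  - by apply/cvg_ex; exists (derive1 F (p n)); apply: cvg_at_right_filter; exact: cF'.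
  - by apply/cvg_ex; exists (derive1 F (q n)); apply: cvg_at_left_filter; exact: cF'.
  - split.
    + move=> x; rewrite in_itv/= => /andP[px xq].
      by have [] : is_derive x 1 F (f x) by apply: dF; apply: (pqA n); rewrite !ltW.
    + by apply: cvg_at_right_filter; exact: cF.
    + by apply: cvg_at_left_filter; exact: cF.
  - apply: continuous_in_subspaceT => y; rewrite inE/= => yF.
    by apply: cG; rewrite BE; exists n.
have mGF n :
    @measurable_fun _ _ (measurableTypeR R) R `[p n, q n] (fun x => G (F x) * f x : R).
  apply: subspace_continuous_measurable_fun => //.
  apply: continuous_in_subspaceT => x; rewrite inE/= in_itv/= => /pqA Ax.
  apply: cvgM; last exact: cf.
  by apply: continuous_comp; [exact: cF|apply: cG; exact: FB].
have mG n : @measurable_fun _ _ (measurableTypeR R) R `[F (p n), F (q n)] G.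
  apply: subspace_continuous_measurable_fun => //.
  apply: continuous_in_subspaceT => y; rewrite inE/= => yF.
  by apply: cG; rewrite BE; exists n.
have mono (u v : R^nat) : nonincreasing_seq u -> nondecreasing_seq v ->
    nondecreasing_seq (fun n => [set` `[u n, v n]]).
  move=> du dv m n mn; rewrite subsetEset; apply: subset_itv.
    by rewrite bnd_simp; exact: du.
  by rewrite bnd_simp; exact: dv.
have monoF : nondecreasing_seq (fun n => [set` `[F (p n), F (q n)]]).
  apply: mono => m n mn.
    by apply: (Fle n) => //; [exact: le_trans (pq m) (iq _ _ mn)|exact: dp].
  by apply: (Fle n) => //; [exact: le_trans (dp _ _ mn) (pq m)|exact: iq].
have monoA := mono _ _ dp iq.
have cB : (\int[lebesgue_measure]_(y in `[F (p n), F (q n)]) (G y)%:E)%E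
    @[n --> \oo] --> (\int[lebesgue_measure]_(y in B) (G y)%:E)%E.
  rewrite [in X in _ --> X]BE.
  apply: (@ge0_nondecreasing_set_cvg_integral _ (measurableTypeR R) R _
    (EFin \o G) lebesgue_measure monoF) => //.
    by move=> n; apply/measurable_EFinP; exact: mG.
  by move=> n y yF; rewrite lee_fin; apply: G0; rewrite BE; exists n.
have cA : (\int[lebesgue_measure]_(x in `[p n, q n]) (G (F x) * f x)%:E)%E
    @[n --> \oo] --> (\int[lebesgue_measure]_(x in A) (G (F x) * f x)%:E)%E.
  rewrite [in X in _ --> X]AE.
  apply: (@ge0_nondecreasing_set_cvg_integral _ (measurableTypeR R) R _
    (EFin \o (fun x => G (F x) * f x)) lebesgue_measure monoA) => //.
    by move=> n; apply/measurable_EFinP; exact: mGF.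
  move=> n x /=; rewrite in_itv/= lee_fin => /pqA Ax.
  by rewrite mulr_ge0 ?G0 ?ltW ?f0//; exact: FB.
rewrite (funext fE) in cB.
exact: (cvg_unique _ cB cA).
Unshelve. all: by end_near. Qed.

Lemma segment_exhaustible_itv0y (R : realType) :
  segment_exhaustible `]0 : R, +oo[%classic.
Proof.
exists (fun n => n.+1%:R^-1), (fun n => n.+1%:R); split.
- by move=> m n mn; rewrite lef_pV2 ?posrE// ler_nat.
- by move=> m n mn; rewrite ler_nat.
- move=> n; apply: (@le_trans _ _ 1); last by rewrite ler1n.
  by rewrite invf_le1// ler1n.
apply/seteqP; split => [x|x [n _]]/=; rewrite !in_itv/= ?andbT.
  move=> x0; near \oo => n; exists n => //=; rewrite in_itv/=; apply/andP; split.
    rewrite invf_ple ?posrE// (@le_trans _ _ n%:R)// ?ler_nat//.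
    near: n; exact: nbhs_infty_ger.
  rewrite (@le_trans _ _ n%:R)// ?ler_nat//.
  near: n; exact: nbhs_infty_ger.
by move=> /andP[+ _]; exact: lt_le_trans.
Unshelve. all: by end_near. Qed.

Lemma segment_exhaustible_itvoo (R : realType) (s t : R) : s < t ->
  segment_exhaustible `]s, t[%classic.
Proof.
rewrite -subr_gt0 => st.
exists (fun n => s + (t - s) / n.+2%:R), (fun n => t - (t - s) / n.+2%:R); split.
- move=> m n mn; rewrite lerD2l ler_pM2l//.
  by rewrite lef_pV2 ?posrE// ler_nat.
- move=> m n mn; rewrite lerD2l lerN2 ler_pM2l//.
  by rewrite lef_pV2 ?posrE// ler_nat.
- move=> n; have : (t - s) / n.+2%:R <= (t - s) / 2.
    by rewrite ler_pM2l// lef_pV2 ?posrE// ler_nat.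
  by move: (_ / n.+2%:R) => z z2; lra.
apply/seteqP; split => [x|x [n _]]/=; rewrite !in_itv/=.
  move=> /andP[sx xt].
  near \oo => n; exists n => //=; rewrite in_itv/=.
  have n0 : 0 < n.+2%:R :> R by [].
  have h1 : (t - s) / (x - s) <= n.+2%:R.
    apply: (@le_trans _ _ n%:R); last by rewrite ler_nat ltnW.
    near: n; exact: nbhs_infty_ger.
  have h2 : (t - s) / (t - x) <= n.+2%:R.
    apply: (@le_trans _ _ n%:R); last by rewrite ler_nat ltnW.
    near: n; exact: nbhs_infty_ger.
  rewrite ler_pdivrMr ?subr_gt0// mulrC -ler_pdivrMr// in h1.
  rewrite ler_pdivrMr ?subr_gt0// mulrC -ler_pdivrMr// in h2.
  by move: h1 h2; set d := (t - s) / _ => h1 h2; apply/andP; split; lra.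
have : 0 < (t - s) / n.+2%:R by rewrite divr_gt0.
by set d := (t - s) / _ => h /andP[h1 h2]; apply/andP; split; lra.
Unshelve. all: by end_near. Qed.

Lemma continuous_powR (R : realType) (p x : R) : 0 < x ->
  {for x, continuous (fun y => y `^ p)}.
Proof.
move=> x0; have [d _] := is_derive1_powR p x0.
exact/differentiable_continuous/derivable1_diffP.
Qed.

Lemma integral_mkcond_if d (T : measurableType d) (R : realType)
    (mu : {measure set T -> \bar R}) (P : pred T) (h : T -> \bar R) :
  (\int[mu]_(x in [set x | P x]) h x = \int[mu]_x (if P x then h x else 0))%E.
Proof.
rewrite integral_mkcond; apply: eq_integral => x _.
rewrite patchE; congr (if _ then _ else _).
by apply/idP/idP => [/set_mem//|Px]; exact/mem_set.
Qed.

(** * The Gamma function *)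

(** With y = s / (2 x), this is y <= exp y raised to the power x. *)
Lemma powR_le_expR (R : realType) (x s : R) : 0 < x -> 0 < s ->
  s `^ x <= (2 * x) `^ x * expR (2^-1 * s).
Proof.
move=> x0 s0; have x20 : 0 < 2 * x by rewrite mulr_gt0.
rewrite (_ : 2^-1 * s = s / (2 * x) * x); last by field; lra.
rewrite expRM -powRM ?expR_ge0 ?(ltW x20)//.
apply: (ge0_ler_powR (ltW x0)); first by rewrite nnegrE ltW.
  by rewrite nnegrE mulr_ge0 ?expR_ge0// ltW.
rewrite mulrC -ler_pdivrMr//.
by apply: le_trans (expR_ge1Dx _); rewrite lerDr.
Qed.

Lemma integral_powR01 (R : realType) (x : R) : 0 < x ->
  (\int[lebesgue_measure]_(s in `]0%R, 1%R[) (s `^ (x - 1))%:E = (x^-1)%:E)%E.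
Proof.
move=> x0.
have := @ge0_integration_by_substitution_exhaustion R (fun s => s `^ x / x)
  (fun s => s `^ (x - 1)) (cst 1) `]0, 1[%classic `]0, x^-1[%classic.
move=> H.
have -> : (\int[lebesgue_measure]_(s in `]0%R, 1%R[) (s `^ (x - 1))%:E =
   \int[lebesgue_measure]_(s in `]0%R, 1%R[) (1 * s `^ (x - 1))%:E)%E.
  by apply: eq_integral => s _; rewrite mul1r.
rewrite -[LHS]H//=.
- by rewrite integral_cst//= mul1e lebesgue_measure_itv/= lte_fin invr_gt0 x0 sube0.
- exact: segment_exhaustible_itvoo.
- move=> s; rewrite /= in_itv/= => /andP[s0 s1].
  have -> : s `^ (x - 1) = x^-1 *: (x * s `^ (x - 1)).
    by rewrite /GRing.scale/= mulKf// gt_eqF.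
  rewrite (_ : (fun s => _) = x^-1 *: (@powR R ^~ x)).
    by apply: is_deriveZ; exact: is_derive1_powR.
  by apply/funext => y /=; rewrite mulrC.
- by move=> s; rewrite in_itv/= => /andP[s0 s1]; rewrite powR_gt0.
- by move=> s; rewrite in_itv/= => /andP[s0 s1]; exact: continuous_powR.
- move=> s; rewrite !in_itv/= => /andP[s0 s1].
  rewrite divr_gt0 ?powR_gt0//= -[ltRHS]mul1r ltr_pM2r ?invr_gt0//.
  by rewrite -[ltRHS](congr1 (fun h => h x) (@powR1 R)) gt0_ltr_powR ?nnegrE// ltW.
- move=> y; rewrite in_itv/= => /andP[y0 yx].
  have xy0 : 0 < x * y by rewrite mulr_gt0.
  exists ((x * y) `^ x^-1).
    rewrite in_itv/= powR_gt0//=.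
    rewrite -[ltRHS](congr1 (fun h => h x^-1) (@powR1 R)).
    by rewrite gt0_ltr_powR ?nnegrE ?invr_gt0// ?ltW// -ltr_pdivlMl// mulr1.
  by rewrite -powRrM mulVf ?gt_eqF// powRr1 ?ltW// mulrAC divff ?gt_eqF// mul1r.
- move=> y _; exact: cst_continuous.
Qed.

Definition gamma_integrand (R : realType) (x s : R) : R :=
  s `^ (x - 1) * expR (- s).

Lemma gamma_integrand_ge0 (R : realType) (x s : R) : 0 <= gamma_integrand x s.
Proof. by rewrite mulr_ge0 ?powR_ge0 ?expR_ge0. Qed.

Lemma measurable_gamma_integrand (R : realType) (x : R) (D : set R) :
  @measurable_fun _ _ (measurableTypeR R) R D (gamma_integrand x).
Proof.
apply: measurable_funTS; apply: measurable_funM; first exact: measurable_powR.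
by apply: measurableT_comp => //; exact: measurable_expR.
Qed.

(** Gamma is a real-valued integral, hence 0 if the underlying integral were
    infinite.  Near 0 the integrand is below s^(x-1), and beyond 1 it is below
    (2x)^x exp(-s/2). *)
Lemma integral_gamma_lty (R : realType) (x : R) : 0 < x ->
  (\int[lebesgue_measure]_(s in `]0%R, +oo[) (gamma_integrand x s)%:E < +oo)%E.
Proof.
move=> x0.
pose C : R := (2 * x) `^ x.
have C0 : 0 <= C by exact: powR_ge0.
have half : 0 < 2^-1 :> R by rewrite invr_gt0.
rewrite (@itv_bndbnd_setU _ _ _ (BLeft (1 : R))) ?bnd_simp//.
rewrite ge0_integral_setU//=; last 3 first.
- by apply/measurable_EFinP; exact: measurable_gamma_integrand.
- by move=> s _; rewrite lee_fin gamma_integrand_ge0.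
- rewrite disj_set2E; apply/eqP/seteqP; split => // s [] /=.
  by rewrite !in_itv/= andbT => /andP[_ +] => /lt_le_trans h /h; rewrite ltxx.
apply: lte_add_pinfty.
  apply: (@le_lt_trans _ _ (x^-1)%:E); last exact: ltry.
  rewrite -integral_powR01//; apply: ge0_le_integral => //=.
  - by move=> s _; rewrite lee_fin gamma_integrand_ge0.
  - by apply/measurable_EFinP; exact: measurable_gamma_integrand.
  - apply/measurable_EFinP; apply: measurable_funTS; exact: measurable_powR.
  - move=> s; rewrite in_itv/= => /andP[s0 _]; rewrite lee_fin.
    by rewrite ler_piMr ?powR_ge0// -expR0 ler_expR oppr_le0 ltW.
apply: (@le_lt_trans _ _ (2 * C)%:E); last exact: ltry.
rewrite -[leRHS]mule1 -(@integral_exponential_pdf _ _ half) -ge0_integralZl_EFin//=; last 3 first.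
- by move=> s _; rewrite lee_fin exponential_pdf_ge0// ltW.
- by apply/measurable_EFinP; exact: measurable_exponential_pdf.
- by rewrite mulr_ge0.
apply: (@le_trans _ _ (\int[lebesgue_measure]_(s in `[1%R, +oo[)
    ((2 * C)%:E * (exponential_pdf 2^-1 s)%:E))%E).
  apply: ge0_le_integral => //=.
  - by move=> s _; rewrite lee_fin gamma_integrand_ge0.
  - by apply/measurable_EFinP; exact: measurable_gamma_integrand.
  - apply/measurable_EFinP; apply: measurable_funTS; apply: measurable_funM => //.
    exact: measurable_exponential_pdf.
  - move=> s; rewrite in_itv/= andbT => s1.
    have s0 : 0 < s by exact: lt_le_trans s1.
    rewrite -EFinM lee_fin exponential_pdfE ?(ltW s0)//.
    apply: (@le_trans _ _ (s `^ x * expR (- s))).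
      by rewrite ler_wpM2r ?expR_ge0// ler_powR// gerBl.
    apply: (@le_trans _ _ (C * expR (2^-1 * s) * expR (- s))).
      by rewrite ler_wpM2r ?expR_ge0// powR_le_expR.
    rewrite -mulrA -expRD (_ : 2^-1 * s - s = - 2^-1 * s); last by lra.
    by rewrite [X in _ <= X * _]mulrC -mulrA mulVKf.
apply: ge0_subset_integral => //=.
- apply/measurable_EFinP; apply: measurable_funM => //.
  exact: measurable_exponential_pdf.
- by move=> s _; rewrite -EFinM lee_fin !mulr_ge0// exponential_pdf_ge0// ltW.
Qed.

Lemma Gamma_ge0 (R : realType) (x : R) : 0 <= Gamma x.
Proof. by apply: Rintegral_ge0 => s _; exact: gamma_integrand_ge0. Qed.

Lemma EFin_Gamma (R : realType) (x : R) : 0 < x ->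
  ((Gamma x)%:E =
   \int[lebesgue_measure]_(s in `]0%R, +oo[) (gamma_integrand x s)%:E)%E.
Proof.
move=> x0; rewrite /Gamma /Rintegral fineK// ge0_fin_numE ?integral_gamma_lty//.
by apply: integral_ge0 => s _; rewrite lee_fin gamma_integrand_ge0.
Qed.

(** Restrict Euler's integral to [N, N + 1], where s^(x-1) = s^x / s is at
    least N^x / (N + 1).  Positivity of Gamma and its superexponential growth
    are both read off this bound. *)
Lemma Gamma_lower_bound (R : realType) (x N : R) : 0 < x -> 0 < N ->
  N `^ x * expR (- (N + 1)) / (N + 1) <= Gamma x.
Proof.
move=> x0 N0; set c := leLHS.
have N10 : 0 < N + 1 by rewrite addr_gt0.
have c0 : 0 <= c by rewrite divr_ge0 ?mulr_ge0 ?powR_ge0 ?expR_ge0 ?ltW.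
rewrite -lee_fin EFin_Gamma//.
apply: (@le_trans _ _
    (\int[lebesgue_measure]_(s in `[N, (N + 1)%R]) (gamma_integrand x s)%:E)%E).
  rewrite (_ : c%:E = \int[lebesgue_measure]_(s in `[N, (N + 1)%R]) cst c%:E s)%E.
    apply: ge0_le_integral => //=.
      by apply/measurable_EFinP; exact: measurable_gamma_integrand.
    move=> s; rewrite in_itv/= => /andP[Ns sN].
    have s0 : 0 < s by exact: lt_le_trans Ns.
    have sE : s `^ (x - 1) = s `^ x / s.
      by rewrite powRB ?powRr1 ?(ltW s0)//; apply/implyP => _; rewrite gt_eqF.
    rewrite lee_fin /gamma_integrand sE.
    rewrite /c mulrAC; apply: ler_pM.
    - by rewrite divr_ge0 ?powR_ge0 ?(ltW N10).
    - exact: expR_ge0.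
    - apply: ler_pM; rewrite ?powR_ge0 ?invr_ge0 ?(ltW N10)//.
        by apply: (ge0_ler_powR (ltW x0)); rewrite ?nnegrE ?(ltW N0) ?(ltW s0).
      by rewrite lef_pV2 ?posrE.
    - by rewrite ler_expR lerN2.
  rewrite integral_cst//= lebesgue_measure_itv/= lte_fin ltrDl ltr01.
  by rewrite -EFinB addrAC subrr add0r mule1.
apply: ge0_subset_integral => //=.
- by apply/measurable_EFinP; exact: measurable_gamma_integrand.
- by move=> s _; rewrite lee_fin gamma_integrand_ge0.
- move=> s; rewrite /= !in_itv/= andbT => /andP[+ _]; exact: lt_le_trans.
Qed.

Lemma Gamma_gt0 (R : realType) (x : R) : 0 < x -> 0 < Gamma x.
Proof.
move=> x0; apply: lt_le_trans (Gamma_lower_bound x0 ltr01).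
by rewrite divr_gt0 ?mulr_gt0 ?expR_gt0 ?powR_gt0.
Qed.

Lemma Gamma1 (R : realType) : Gamma (1 : R) = 1.
Proof.
apply: EFin_inj; rewrite EFin_Gamma// -(integral_exponential_pdf (@ltr01 R)).
rewrite integral_itv_obnd_cbnd; last first.
  by apply/measurable_EFinP; exact: measurable_gamma_integrand.
rewrite integral_mkcond; apply: eq_integral => s _.
rewrite /exponential_pdf !patchE; case: ifPn => // _.
by rewrite /gamma_integrand subrr powRr0 !mul1r mulN1r.
Qed.

(** * Euler's beta integral *)

Lemma integral_itv0y (R : realType) (h : measurableTypeR R -> \bar R) :
  (\int[lebesgue_measure]_(s in `]0%R, +oo[) h s =
   \int[lebesgue_measure]_s (if (0 < s)%R then h s else 0))%E.
Proof.
rewrite -(integral_mkcond_if _ (fun s : measurableTypeR R => (0 < (s : R))%R)).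
by congr integral; apply/seteqP; split => s; rewrite /= in_itv/= andbT.
Qed.

Lemma Gamma_rescale (R : realType) (x c : R) : 0 < x -> 0 < c ->
  ((Gamma x)%:E =
   \int[lebesgue_measure]_(s in `]0%R, +oo[) (gamma_integrand x (c * s) * c)%:E)%E.
Proof.
move=> x0 c0; rewrite EFin_Gamma//.
apply: (@ge0_integration_by_substitution_exhaustion R (fun s => c * s)
  (cst c) (gamma_integrand x)).
- exact: interval_open.
- exact: segment_exhaustible_itv0y.
- move=> s _ /=.
  have -> : c = c *: 1 by rewrite /GRing.scale/= mulr1.
  rewrite (_ : (fun s => _) = c *: id); last by apply/funext => y; rewrite scaler1.
  by apply: is_deriveZ.
- by [].
- by move=> s _; exact: cst_continuous.
- by move=> s; rewrite /= !in_itv/= !andbT; exact: mulr_gt0.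
- move=> y; rewrite /= in_itv/= andbT => y0; exists (y / c).
    by rewrite /= in_itv/= andbT divr_gt0.
  by rewrite mulrC divfK// gt_eqF.
- move=> y; rewrite /= in_itv/= andbT => y0.
  apply: cvgM; first exact: continuous_powR.
  by apply: continuous_comp; [exact: opp_continuous|exact: continuous_expR].
- by move=> y _; exact: gamma_integrand_ge0.
Qed.

Lemma measurable_gamma_integrand_comp d (T : measurableType d) (R : realType)
    (x : R) (h : T -> R) :
  measurable_fun setT h -> measurable_fun setT (fun z => gamma_integrand x (h z)).
Proof.
by move=> mh; apply: measurableT_comp mh; exact: measurable_gamma_integrand.
Qed.

(** Euler's beta integral on the half line: substitute y := s w in the integral
    of the second factor, exchange the two integrals, and recognise the inner
    one as Gamma(x + y) rescaled by 1 + w. *)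
Lemma Gamma_mul_integral (R : realType) (x y : R) : 0 < x -> 0 < y ->
  ((Gamma x * Gamma y)%:E = (Gamma (x + y))%:E *
   \int[lebesgue_measure]_(w in `]0%R, +oo[)
      (w `^ (y - 1) * (1 + w) `^ (- (x + y)))%:E)%E.
Proof.
move=> x0 y0; have xy0 : 0 < x + y by rewrite addr_gt0.
pose T := measurableTypeR R.
pose f (z : T * T) : R := if 0 < z.1 then if 0 < z.2 then
  gamma_integrand x z.1 * (gamma_integrand y (z.1 * z.2) * z.1) else 0 else 0.
have f0 z : (0 <= (f z)%:E)%E.
  rewrite lee_fin /f; case: ifPn => // z0; case: ifPn => // _.
  by do 2 (apply: mulr_ge0; first exact: gamma_integrand_ge0); exact: ltW.
have mf : measurable_fun setT f.
  have m1 : measurable_fun setT (fun z : T * T => z.1 : R) by exact: measurable_fst.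
  have m2 : measurable_fun setT (fun z : T * T => z.2 : R) by exact: measurable_snd.
  do 2 (apply: measurable_fun_ifT => //; first exact: measurable_fun_ltr).
  apply: measurable_funM; first exact: measurable_gamma_integrand_comp.
  apply: measurable_funM => //; apply: measurable_gamma_integrand_comp.
  exact: measurable_funM.
have fL s : (\int[lebesgue_measure]_w (f (s, w))%:E = if (0 < s)%R then
    (gamma_integrand x s)%:E * (Gamma y)%:E else 0)%E.
  rewrite /f/=; case: ifPn => s0; last by rewrite integral0_eq.
  rewrite (Gamma_rescale y0 s0) -ge0_integralZl_EFin ?gamma_integrand_ge0//=; last 2 first.
  - by move=> w _; rewrite lee_fin mulr_ge0 ?gamma_integrand_ge0 ?(ltW s0).
  - apply: measurable_funTS; apply/measurable_EFinP; apply: measurable_funM => //.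
    by apply: measurable_gamma_integrand_comp; exact: measurable_funM.
  rewrite [RHS]integral_itv0y; apply: eq_integral => w _.
  by case: ifPn.
have fR w : (\int[lebesgue_measure]_s (f (s, w))%:E = if (0 < w)%R then
    (Gamma (x + y))%:E * (w `^ (y - 1) * (1 + w) `^ (- (x + y)))%:E else 0)%E.
  rewrite /f/=; case: ifPn => w0; last first.
    by rewrite integral0_eq// => s _; rewrite if_same.
  have w10 : 0 < 1 + w by rewrite addr_gt0.
  rewrite (Gamma_rescale xy0 w10) muleC -ge0_integralZl_EFin//=; last 3 first.
  - by move=> s _; rewrite lee_fin mulr_ge0 ?gamma_integrand_ge0 ?(ltW w10).
  - apply: measurable_funTS; apply/measurable_EFinP; apply: measurable_funM => //.
    by apply: measurable_gamma_integrand_comp; exact: measurable_funM.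
  - by rewrite mulr_ge0 ?powR_ge0.
  rewrite [RHS]integral_itv0y; apply: eq_integral => s _.
  case: ifPn => // s0.
  rewrite -EFinM; congr EFin; rewrite /gamma_integrand.
  have eE : expR (- ((1 + w) * s)) = expR (- s) * expR (- (s * w)).
    by rewrite -expRD; congr expR; ring.
  (* The powers are compared through logarithms. *)
  have pE : s `^ (x - 1) * ((s * w) `^ (y - 1) * s) =
      w `^ (y - 1) * (1 + w) `^ (- (x + y)) *
      (((1 + w) * s) `^ (x + y - 1) * (1 + w)).
    move: (1 + w) w10 => c c0.
    have [p ->] : exists p, s = expR p by exists (ln s); rewrite lnK.
    have [q ->] : exists q, w = expR q by exists (ln w); rewrite lnK.
    have [r ->] : exists r, c = expR r by exists (ln c); rewrite lnK.
    by rewrite -!expRD -!expRM -!expRD; congr expR; ring.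
  rewrite eE; move: pE; set A := s `^ _; set B := (s * w) `^ _.
  set C := w `^ _; set D := _ `^ (- _); set E := _ `^ (_ + _ - 1) => pE.
  have -> : A * expR (- s) * (B * expR (- (s * w)) * s) =
    A * (B * s) * (expR (- s) * expR (- (s * w))) by ring.
  by rewrite pE; ring.
transitivity (\int[lebesgue_measure]_s \int[lebesgue_measure]_w (f (s, w))%:E)%E.
  under eq_integral do rewrite fL.
  rewrite -integral_itv0y ge0_integralZr ?lee_fin ?Gamma_ge0//=.
  - by rewrite -EFin_Gamma.
  - by apply/measurable_EFinP; exact: measurable_gamma_integrand.
  - by move=> s _; rewrite lee_fin gamma_integrand_ge0.
rewrite (fubini_tonelli (EFin \o f)) => [|//|//]; last exact/measurable_EFinP.
under eq_integral do rewrite fR.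
rewrite -integral_itv0y ge0_integralZl_EFin ?Gamma_ge0//=.
- by move=> s _; rewrite lee_fin mulr_ge0 ?powR_ge0.
- apply/measurable_EFinP; apply: measurable_funTS; apply: measurable_funM.
    exact: measurable_powR.
  by apply: (measurableT_comp (measurable_powR _)); exact: measurable_funD.
Qed.

(** The map F r = (r^rho - s^rho) / (t^rho - r^rho) sends ]s, t[ onto the half
    line and carries this integral to the one of [Gamma_mul_integral]. *)
Lemma power_kernel_integral (R : realType) (rho alpha beta s t : R) :
  0 < rho -> 0 < alpha -> 0 < beta -> 0 < s -> s < t ->
  (\int[lebesgue_measure]_(r in `]s, t[)
     (r `^ (rho - 1) * (t `^ rho - r `^ rho) `^ (alpha - 1) *
      (r `^ rho - s `^ rho) `^ (beta - 1))%:E =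
   ((t `^ rho - s `^ rho) `^ (alpha + beta - 1) / rho *
    (Gamma alpha * Gamma beta / Gamma (alpha + beta)))%:E)%E.
Proof.
move=> rho0 a0 b0 s0 st; have ab0 : 0 < alpha + beta by rewrite addr_gt0.
have t0 : 0 < t by exact: lt_trans st.
have pow_lt x y : 0 < x -> x < y -> x `^ rho < y `^ rho.
  move=> x0 xy; apply: gt0_ltr_powR; rewrite ?nnegrE ?(ltW x0)//.
  exact/ltW/(lt_trans x0).
set S := s `^ rho; set T := t `^ rho.
have ST : S < T by exact: pow_lt.
have D0 : 0 < T - S by rewrite subr_gt0.
(* Rewriting F as (T - S) / (T - r^rho) - 1 leaves a single reciprocal to
   differentiate. *)
pose F r : R := (T - S) * (T - r `^ rho)^-1 - 1.
pose f r : R := (T - S) * ((T - r `^ rho) ^- 2 * (rho * r `^ (rho - 1))).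
pose G w : R := w `^ (beta - 1) * (1 + w) `^ (- (alpha + beta)).
have rP r : r \in `]s, t[ -> [/\ 0 < r, 0 < T - r `^ rho & 0 < r `^ rho - S].
  rewrite in_itv/= => /andP[sr rt]; have r0 : 0 < r by exact: lt_trans sr.
  by rewrite !subr_gt0; split => //; apply: pow_lt.
have dF r : r \in `]s, t[ -> is_derive r 1 F (f r).
  move=> /rP[r0 rT Sr].
  have dTr : is_derive r 1 (fun y => T - y `^ rho) (- (rho * r `^ (rho - 1))).
    rewrite -[X in is_derive _ _ _ X]sub0r.
    by apply: (@is_deriveB _ _ _ (cst T)); exact: is_derive1_powR.
  have TrN0 : T - r `^ rho != 0 by rewrite gt_eqF.
  have dV := @is_deriveV _ (fun y => T - y `^ rho) r _ _ TrN0 dTr.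
  have := is_deriveB (is_deriveZ (T - S) dV) (is_derive_cst (1 : R) r 1).
  rewrite subr0 /GRing.scale/= mulrNN; exact.
have FE r : r \in `]s, t[ -> F r = (r `^ rho - S) / (T - r `^ rho).
  by move=> /rP[r0 rT Sr]; rewrite /F; field; rewrite gt_eqF.
have GFf r : r \in `]s, t[ -> G (F r) * f r =
    rho * (T - S) `^ (1 - alpha - beta) *
    (r `^ (rho - 1) * (T - r `^ rho) `^ (alpha - 1) * (r `^ rho - S) `^ (beta - 1)).
  move=> rI; have [r0 rT Sr] := rP _ rI; rewrite FE// /G /f.
  have -> : 1 + (r `^ rho - S) / (T - r `^ rho) = (T - S) / (T - r `^ rho).
    by field; rewrite gt_eqF.
  move: (r `^ (rho - 1)) (T - r `^ rho) (r `^ rho - S) (T - S) rT Sr D0.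
  move=> A X Y D X0 Y0 D0'.
  have -> : (Y / X) `^ (beta - 1) * (D / X) `^ (- (alpha + beta)) *
    (D * (X ^- 2 * (rho * A))) = rho * A * ((Y / X) `^ (beta - 1) *
    (D / X) `^ (- (alpha + beta)) * D * X^-1 * X^-1) by rewrite expr2 invfM; ring.
  have -> : rho * D `^ (1 - alpha - beta) * (A * X `^ (alpha - 1) * Y `^ (beta - 1)) =
    rho * A * (D `^ (1 - alpha - beta) * X `^ (alpha - 1) * Y `^ (beta - 1)) by ring.
  congr (_ * _).
  have [p ->] : exists p, X = expR p by exists (ln X); rewrite lnK.
  have [q ->] : exists q, Y = expR q by exists (ln Y); rewrite lnK.
  have [z ->] : exists z, D = expR z by exists (ln D); rewrite lnK.
  by rewrite -!expRN -!expRD -!expRM -!expRD; congr expR; ring.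
have cF r : r \in `]s, t[ -> {for r, continuous F}.
  by move=> /dF[dFr _]; exact/differentiable_continuous/derivable1_diffP.
have cf r : r \in `]s, t[ -> {for r, continuous f}.
  move=> /rP[r0 rT Sr].
  have cTr : {for r, continuous (fun y => T - y `^ rho)}.
    by apply: cvgB; [exact: cvg_cst|exact: continuous_powR].
  apply: cvgM; first exact: cvg_cst.
  apply: cvgM.
    apply: cvgV; first by rewrite expf_neq0// gt_eqF.
    by rewrite expr2; under eq_fun do rewrite expr2; apply: cvgM.
  by apply: cvgM; [exact: cvg_cst|exact: continuous_powR].
have cG w : 0 < w -> {for w, continuous G}.
  move=> w0; apply: cvgM; first exact: continuous_powR.
  have c1 : {for w, continuous (fun w : R => 1 + w)}.
    by apply: cvgD; [exact: cvg_cst|exact: cvg_id].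
  have c2 : {for 1 + w, continuous (fun y : R => y `^ (- (alpha + beta)))}.
    by apply: continuous_powR; exact: addr_gt0.
  exact: (continuous_comp c1 c2).
have F_surj w : 0 < w -> exists2 r, r \in `]s, t[ & F r = w.
  move=> w0; have w10 : 0 < 1 + w by rewrite addr_gt0.
  pose y := (w * T + S) / (1 + w).
  have yS : S < y by rewrite ltr_pdivlMr//; nra.
  have yT : y < T by rewrite ltr_pdivrMr//; nra.
  have S0 : 0 < S by exact: powR_gt0.
  have y0 : 0 < y by exact: lt_trans yS.
  have rho_inv x : 0 < x -> (x `^ rho) `^ rho^-1 = x.
    by move=> x0; rewrite -powRrM divff ?gt_eqF// powRr1// ltW.
  have rho_lt x z : 0 < x -> x < z -> x `^ rho^-1 < z `^ rho^-1.
    move=> x0 xz; apply: gt0_ltr_powR; rewrite ?invr_gt0 ?nnegrE ?(ltW x0)//.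
    exact/ltW/(lt_trans x0).
  have yI : y `^ rho^-1 \in `]s, t[.
    rewrite in_itv/= -[ltLHS](rho_inv s)// -[X in _ && (_ < X)](rho_inv t)//.
    by rewrite !rho_lt.
  exists (y `^ rho^-1) => //.
  rewrite FE// -powRrM mulVf ?gt_eqF// powRr1 ?(ltW y0)// /y.
  by field; rewrite !gt_eqF//; nra.
set I := LHS.
have IE : ((Gamma alpha * Gamma beta)%:E =
    (Gamma (alpha + beta))%:E * ((rho * (T - S) `^ (1 - alpha - beta))%:E * I))%E.
  rewrite Gamma_mul_integral//; congr (_ * _)%E.
  rewrite [LHS](@ge0_integration_by_substitution_exhaustion R F f G
    `]s, t[%classic `]0, +oo[%classic).
  - rewrite /I -ge0_integralZl_EFin//=; last 3 first.
    + by move=> r _; rewrite lee_fin !mulr_ge0// powR_ge0.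
    + apply/measurable_EFinP; apply: measurable_funTS.
      have mr : measurable_fun setT (fun r : measurableTypeR R => r `^ rho).
        exact: measurable_powR.
      apply: measurable_funM; first apply: measurable_funM.
      * exact: measurable_powR.
      * by apply: (measurableT_comp (measurable_powR _)); exact: measurable_funB.
      * by apply: (measurableT_comp (measurable_powR _)); exact: measurable_funB.
    + by rewrite mulr_ge0 ?powR_ge0 ?ltW.
    by apply: eq_integral => r /set_mem/= rI; rewrite GFf// EFinM.
  - exact: interval_open.
  - exact: segment_exhaustible_itvoo.
  - move=> r /rP[r0 rT Sr]; rewrite /f !mulr_gt0 ?invr_gt0 ?exprn_gt0//.
    by rewrite powR_gt0.
  - exact: cf.
  - move=> r rI; have [r0 rT Sr] := rP _ rI.
    by rewrite FE// /= in_itv/= andbT divr_gt0.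
  - by move=> w; rewrite /= in_itv/= andbT => /F_surj[r rI <-]; exists r.
  - by move=> w; rewrite /= in_itv/= andbT; exact: cG.
  - by move=> w _; rewrite mulr_ge0 ?powR_ge0.
have G0 : Gamma (alpha + beta) != 0 by rewrite gt_eqF// Gamma_gt0.
have -> : I = ((Gamma (alpha + beta) * (rho * (T - S) `^ (1 - alpha - beta)))^-1%:E *
    (Gamma alpha * Gamma beta)%:E)%E.
  rewrite IE [X in (_ * X)%E]muleA -[X in (_ * (X * _))%E]EFinM muleA -EFinM.
  rewrite mulVf ?mul1e// !mulf_neq0// gt_eqF//.
  exact: powR_gt0.
rewrite -EFinM; congr EFin.
have -> : (T - S) `^ (1 - alpha - beta) = ((T - S) `^ (alpha + beta - 1))^-1.
  by rewrite -powRN; congr (_ `^ _); ring.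
have p0 : (T - S) `^ (alpha + beta - 1) != 0 by rewrite gt_eqF// powR_gt0.
move: G0 p0 (lt0r_neq0 rho0); move: (Gamma alpha) (Gamma beta) (Gamma _) (_ `^ _).
by move=> A B C D C0 D0' rho0'; field; rewrite C0 D0' rho0'.
Qed.

(** * Fractional integrals over an abstract space *)

Definition katugampola_kernel (R : realType) (a rho beta t r : R) : R :=
  if (a <= r) && (r <= t) then
    rho `^ (1 - beta) / Gamma beta * r `^ (rho - 1) *
    (t `^ rho - r `^ rho) `^ (beta - 1)
  else 0.

Lemma katugampola_kernel_ge0 (R : realType) (a rho beta t r : R) :
  0 <= katugampola_kernel a rho beta t r.
Proof.
rewrite /katugampola_kernel; case: ifPn => // _.
by rewrite !mulr_ge0 ?powR_ge0 ?invr_ge0 ?Gamma_ge0.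
Qed.

Lemma measurable_katugampola_kernel d (T : measurableType d) (R : realType)
    (a rho beta : R) (h1 h2 : T -> R) :
  measurable_fun setT h1 -> measurable_fun setT h2 ->
  measurable_fun setT (fun z => katugampola_kernel a rho beta (h1 z) (h2 z)).
Proof.
move=> m1 m2.
have mpow p (h : T -> R) : measurable_fun setT h ->
    measurable_fun setT (fun z => h z `^ p).
  by move=> mh; exact: (measurableT_comp (measurable_powR p) mh).
apply: measurable_fun_ifT => //.
  by apply: measurable_and; apply: measurable_fun_ler.
apply: measurable_funM; first by apply: measurable_funM => //; exact: mpow.
by apply: (mpow); apply: measurable_funB; exact: mpow.
Qed.

(** The composed kernel vanishes unless s <= r <= t, where it is the integrand
    of [power_kernel_integral].  Equality can fail on the diagonal s = t: the
    left side is then 0, while 0 `^ 0 = 1 makes the right side positive when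
    alpha + beta = 1. *)
Lemma katugampola_kernel_comp (R : realType) (a rho alpha beta t s : R) :
  0 < a -> 0 < rho -> 0 < alpha -> 0 < beta ->
  (\int[lebesgue_measure]_r (katugampola_kernel a rho alpha t r *
     katugampola_kernel a rho beta r s)%:E <=
   (katugampola_kernel a rho (alpha + beta) t s)%:E)%E.
Proof.
move=> a0 rho0 al0 be0.
have [as_|sa] := leP a s; last first.
  rewrite integral0_eq ?lee_fin ?katugampola_kernel_ge0// => r _.
  by rewrite /katugampola_kernel [a <= s]leNgt sa/= mulr0.
have s0 : 0 < s by exact: lt_le_trans as_.
pose c := (rho `^ (1 - alpha) / Gamma alpha) * (rho `^ (1 - beta) / Gamma beta)
  * s `^ (rho - 1).
have c0 : 0 <= c by rewrite !mulr_ge0 ?powR_ge0 ?invr_ge0 ?Gamma_ge0.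
pose h (r : R) : R := r `^ (rho - 1) * (t `^ rho - r `^ rho) `^ (alpha - 1) *
      (r `^ rho - s `^ rho) `^ (beta - 1).
have mh : measurable_fun setT (fun r : measurableTypeR R => h r).
  have mr : measurable_fun setT (fun r : measurableTypeR R => r `^ rho).
    exact: measurable_powR.
  apply: measurable_funM; first apply: measurable_funM.
  - exact: measurable_powR.
  - by apply: (measurableT_comp (measurable_powR _)); exact: measurable_funB.
  - by apply: (measurableT_comp (measurable_powR _)); exact: measurable_funB.
have h0 r : 0 <= h r by rewrite !mulr_ge0 ?powR_ge0.
have -> : (\int[lebesgue_measure]_r (katugampola_kernel a rho alpha t r *
     katugampola_kernel a rho beta r s)%:E =
   \int[lebesgue_measure]_(r in `[s, t]) (c%:E * (h r)%:E))%E.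
  rewrite [RHS]integral_mkcond; apply: eq_integral => r _.
  rewrite patchE; case: ifPn => [/set_mem/=|/negP rI].
    rewrite in_itv/= => /andP[sr rt].
    rewrite /katugampola_kernel (le_trans as_ sr) sr rt as_/= -EFinM.
    congr EFin; rewrite /c /h.
    move: (rho `^ (1 - alpha) / _) (rho `^ (1 - beta) / _) (s `^ (rho - 1)).
    move: (r `^ (rho - 1)) (_ `^ (alpha - 1)) (_ `^ (beta - 1)) => *.
    by ring.
  rewrite /katugampola_kernel as_/=; case: ifPn => [/andP[ar rt]|]; last by rewrite mul0r.
  case: ifPn => [sr|]; last by rewrite mulr0.
  by exfalso; apply: rI; apply: mem_set; rewrite /= in_itv/= sr rt.
rewrite ge0_integralZl_EFin//=; last 2 first.
- by move=> r _; rewrite lee_fin.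
- by apply/measurable_EFinP; apply: measurable_funTS.
have [st|ts] := ltP s t; last first.
  rewrite (@integral_Sset1 _ _ _ s) ?mule0 ?lee_fin ?katugampola_kernel_ge0//.
  move=> r /=; rewrite in_itv/= => /andP[sr rt]; apply/eqP.
  by rewrite eq_le sr (le_trans rt ts).
rewrite (@integral_itv_bndoo _ s t _ true false); last first.
  by apply/measurable_EFinP; apply: measurable_funTS.
rewrite power_kernel_integral// -EFinM lee_fin.
rewrite /katugampola_kernel as_ (ltW st)/= /c.
have G1 : Gamma alpha != 0 by rewrite gt_eqF// Gamma_gt0.
have G2 : Gamma beta != 0 by rewrite gt_eqF// Gamma_gt0.
have G3 : Gamma (alpha + beta) != 0 by rewrite gt_eqF// Gamma_gt0// addr_gt0.
have r0 : rho != 0 by rewrite gt_eqF.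
have -> : rho `^ (1 - (alpha + beta)) = rho `^ (1 - alpha) * rho `^ (1 - beta) / rho.
  rewrite -[X in _ / X](powRr1 (ltW rho0)) -powRN -!powRD; last 2 first.
  - by rewrite r0 implybT.
  - by rewrite r0 implybT.
  by congr (_ `^ _); ring.
move: (rho `^ (1 - alpha)) (rho `^ (1 - beta)) (s `^ (rho - 1)) (_ `^ (_ + _ - 1)).
move: G1 G2 G3; move: (Gamma alpha) (Gamma beta) (Gamma _) => A B C A0 B0 C0 p q w z.
by rewrite le_eqVlt; apply/orP; left; apply/eqP; field; rewrite A0 B0 C0 r0.
Qed.

(** The image of mu under X is Lebesgue measure, phrased on the integrals that
    are transported. *)
Definition transports_to_lebesgue d (T : measurableType d) (R : realType)
    (mu : {measure set T -> \bar R}) (X : T -> R) : Prop :=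
  forall h : measurableTypeR R -> R, measurable_fun setT h ->
    (forall r, 0 <= h r) ->
    (\int[mu]_x (h (X x))%:E = \int[lebesgue_measure]_r (h r)%:E)%E.

Definition katugampola_integral d (T : measurableType d) (R : realType)
    (mu : {measure set T -> \bar R}) (X : T -> R) (a rho beta : R)
    (phi : T -> \bar R) (t : R) : \bar R :=
  (\int[mu]_x ((katugampola_kernel a rho beta t (X x))%:E * phi x))%E.

Lemma katugampola_integral_ge0 d (T : measurableType d) (R : realType)
    (mu : {measure set T -> \bar R}) (X : T -> R) (a rho beta : R)
    (phi : T -> \bar R) (t : R) :
  (forall x, 0 <= phi x)%E ->
  (0 <= katugampola_integral mu X a rho beta phi t)%E.
Proof.
move=> phi0; apply: integral_ge0 => x _.
by rewrite mule_ge0 ?lee_fin ?katugampola_kernel_ge0.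
Qed.

Lemma measurable_katugampola_integral d (T : measurableType d) (R : realType)
    (mu : {sigma_finite_measure set T -> \bar R}) (X : T -> R) (a rho beta : R)
    (phi : T -> \bar R) :
  measurable_fun setT X -> measurable_fun setT phi -> (forall x, 0 <= phi x)%E ->
  measurable_fun setT (fun x => katugampola_integral mu X a rho beta phi (X x)).
Proof.
move=> mX mphi phi0.
apply: (measurable_fun_fubini_tonelli_F (fun z : T * T =>
  (katugampola_kernel a rho beta (X z.1) (X z.2))%:E * phi z.2)%E).
- apply: emeasurable_funM.
    apply/measurable_EFinP; apply: measurable_katugampola_kernel.
      exact: (measurableT_comp mX measurable_fst).
    exact: (measurableT_comp mX measurable_snd).
  exact: (measurableT_comp mphi measurable_snd).
- by move=> z; rewrite mule_ge0 ?lee_fin ?katugampola_kernel_ge0.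
Qed.

(** Half of the semigroup property: exchange the integrals with Tonelli and
    compare the composed kernel with [katugampola_kernel_comp]. *)
Lemma katugampola_integral_comp_le d (T : measurableType d) (R : realType)
    (mu : {sigma_finite_measure set T -> \bar R}) (X : T -> R)
    (a rho alpha beta : R) (phi : T -> \bar R) (t : R) :
  measurable_fun setT X ->
  transports_to_lebesgue mu X ->
  0 < a -> 0 < rho -> 0 < alpha -> 0 < beta ->
  measurable_fun setT phi -> (forall x, 0 <= phi x)%E ->
  (katugampola_integral mu X a rho alpha
     (fun x => katugampola_integral mu X a rho beta phi (X x)) t <=
   katugampola_integral mu X a rho (alpha + beta) phi t)%E.
Proof.
move=> mX pX a0 rho0 al0 be0 mphi phi0.
have mk p s : measurable_fun setT (fun x => (katugampola_kernel a rho p s (X x))%:E).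
  by apply/measurable_EFinP; exact: measurable_katugampola_kernel.
pose f (z : T * T) := ((katugampola_kernel a rho alpha t (X z.1))%:E *
  ((katugampola_kernel a rho beta (X z.1) (X z.2))%:E * phi z.2))%E.
have mf : measurable_fun setT f.
  apply: emeasurable_funM.
    exact: (measurableT_comp (mk alpha t) measurable_fst).
  apply: emeasurable_funM; last exact: (measurableT_comp mphi measurable_snd).
  apply/measurable_EFinP; apply: measurable_katugampola_kernel.
    exact: (measurableT_comp mX measurable_fst).
  exact: (measurableT_comp mX measurable_snd).
have f0 z : (0 <= f z)%E.
  by rewrite /f !mule_ge0 ?lee_fin ?katugampola_kernel_ge0.
have -> : katugampola_integral mu X a rho alpha
     (fun x => katugampola_integral mu X a rho beta phi (X x)) t =
   (\int[mu]_x \int[mu]_y f (x, y))%E.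
  apply: eq_integral => x _; rewrite /f/= ge0_integralZl_EFin//.
  - by move=> y _; rewrite mule_ge0 ?lee_fin ?katugampola_kernel_ge0.
  - exact: emeasurable_funM.
  - exact: katugampola_kernel_ge0.
rewrite fubini_tonelli//; apply: ge0_le_integral => //=.
- by move=> y _; apply: integral_ge0 => x _; exact: f0.
- exact: (measurable_fun_fubini_tonelli_G f).
- exact: emeasurable_funM.
move=> y _.
have m2 : measurable_fun setT (fun r : measurableTypeR R =>
    katugampola_kernel a rho alpha t r * katugampola_kernel a rho beta r (X y)).
  by apply: measurable_funM; exact: measurable_katugampola_kernel.
have k0 r : 0 <=
    katugampola_kernel a rho alpha t r * katugampola_kernel a rho beta r (X y).
  by rewrite mulr_ge0 ?katugampola_kernel_ge0.
rewrite /f/=; under eq_integral do rewrite muleA -EFinM.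
rewrite ge0_integralZr//=; last 2 first.
- apply/measurable_EFinP.
  exact: (measurableT_comp m2 mX).
- by move=> x _; rewrite lee_fin.
rewrite lee_wpmul2r// (pX _ m2 k0).
exact: katugampola_kernel_comp.
Qed.

(** * Iteration of the Gronwall inequality *)

Lemma unroll_affine_inequality (R : realType) (x v : \bar R) (g : R)
    (A B : nat -> \bar R) :
  0 <= g -> (forall k, 0 <= A k)%E -> (forall k, 0 <= B k)%E ->
  (x <= v + g%:E * B 1%N)%E ->
  (forall k, (0 < k)%N -> B k <= A k + g%:E * B k.+1)%E ->
  forall n, (x <= v + \sum_(1 <= k < n.+1) (g ^+ k)%:E * A k +
    (g ^+ n.+1)%:E * B n.+1)%E.
Proof.
move=> g0 A0 B0 xB BA; elim=> [|n IH].
  by rewrite big_geq// adde0 expr1.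
have gn0 : (0 <= (g ^+ n.+1)%:E)%E by rewrite lee_fin exprn_ge0.
apply: (le_trans IH); apply: (le_trans (leeD2l _ (lee_wpmul2l gn0 (BA _ _)))) => //.
rewrite ge0_muleDr ?mule_ge0 ?lee_fin// muleA -EFinM -exprSr.
by rewrite [in leRHS]big_nat_recr//= !addeA.
Qed.

(** Apply J beta to the hypothesis.  The kernel at (t, r) vanishes unless
    r <= t, where G r <= G t; the factor G thus leaves the integral, and the
    semigroup property merges the two fractional integrals. *)
Lemma katugampola_integral_gronwall_step d (T : measurableType d) (R : realType)
    (mu : {sigma_finite_measure set T -> \bar R}) (X : T -> R)
    (a b rho alpha beta t : R) (u v : T -> \bar R) (G : R -> R) :
  measurable_fun setT X ->
  transports_to_lebesgue mu X ->
  0 < a -> 0 < rho -> 0 < alpha -> 0 < beta ->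
  measurable_fun setT u -> (forall x, 0 <= u x)%E ->
  measurable_fun setT v -> (forall x, 0 <= v x)%E ->
  (forall r, a <= r <= b -> 0 <= G r) ->
  {in `[a, b] &, nondecreasing_fun G} ->
  (forall x, (a <= X x <= b)%R ->
    u x <= v x + (G (X x))%:E * katugampola_integral mu X a rho alpha u (X x))%E ->
  a <= t <= b ->
  (katugampola_integral mu X a rho beta u t <=
   katugampola_integral mu X a rho beta v t +
   (G t)%:E * katugampola_integral mu X a rho (beta + alpha) u t)%E.
Proof.
move=> mX pX a0 rho0 al0 be0 mu_ u0 mv v0 G0 G_nd Hu tab.
have Gt0 : 0 <= G t by exact: G0.
pose k x := katugampola_kernel a rho beta t (X x).
pose J x := katugampola_integral mu X a rho alpha u (X x).
have k0 x : (0 <= (k x)%:E)%E by rewrite lee_fin katugampola_kernel_ge0.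
have J0 x : (0 <= J x)%E by exact: katugampola_integral_ge0.
have mk : measurable_fun setT (fun x => (k x)%:E : \bar R).
  by apply/measurable_EFinP; exact: measurable_katugampola_kernel.
have mJ : measurable_fun setT J by exact: measurable_katugampola_integral.
apply: (@le_trans _ _ (\int[mu]_x ((k x)%:E * v x + (G t)%:E * ((k x)%:E * J x)))%E).
  apply: ge0_le_integral => //=.
  - by move=> x _; rewrite mule_ge0// k0.
  - exact: emeasurable_funM.
  - apply: emeasurable_funD; first exact: emeasurable_funM.
    by apply: emeasurable_funM => //; exact: emeasurable_funM.
  - move=> x _; rewrite muleCA -ge0_muleDr ?mule_ge0 ?lee_fin//.
    rewrite /k /katugampola_kernel; case: ifPn => [/andP[ar rt]|]; last by rewrite !mul0e.
    have rab : a <= X x <= b.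
      by rewrite ar (le_trans rt)//; case/andP: tab.
    apply: lee_wpmul2l.
      by rewrite lee_fin !mulr_ge0 ?powR_ge0 ?invr_ge0 ?Gamma_ge0.
    apply: (le_trans (Hu _ rab)); apply: leeD2l; apply: lee_wpmul2r; first exact: J0.
    by rewrite lee_fin; apply: G_nd; rewrite ?in_itv.
rewrite ge0_integralD//=; last 4 first.
- by move=> x _; rewrite mule_ge0.
- exact: emeasurable_funM.
- by move=> x _; rewrite mule_ge0 ?lee_fin// mule_ge0.
- by apply: emeasurable_funM => //; exact: emeasurable_funM.
rewrite leeD2l// ge0_integralZl_EFin//=; last 2 first.
- by move=> x _; rewrite mule_ge0.
- exact: emeasurable_funM.
by rewrite lee_wpmul2l ?lee_fin//; exact: katugampola_integral_comp_le.
Qed.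

Lemma katugampola_integral_gronwall_iter d (T : measurableType d) (R : realType)
    (mu : {sigma_finite_measure set T -> \bar R}) (X : T -> R)
    (a b rho alpha : R) (u v : T -> \bar R) (G : R -> R) :
  measurable_fun setT X ->
  transports_to_lebesgue mu X ->
  0 < a -> 0 < rho -> 0 < alpha ->
  measurable_fun setT u -> (forall x, 0 <= u x)%E ->
  measurable_fun setT v -> (forall x, 0 <= v x)%E ->
  (forall r, a <= r <= b -> 0 <= G r) ->
  {in `[a, b] &, nondecreasing_fun G} ->
  (forall x, (a <= X x <= b)%R ->
    u x <= v x + (G (X x))%:E * katugampola_integral mu X a rho alpha u (X x))%E ->
  forall n x, a <= X x <= b ->
  (u x <= v x +
   \sum_(1 <= k < n.+1) (G (X x) ^+ k)%:E *
      katugampola_integral mu X a rho (k%:R * alpha) v (X x) +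
   (G (X x) ^+ n.+1)%:E *
      katugampola_integral mu X a rho (n.+1%:R * alpha) u (X x))%E.
Proof.
move=> mX pX a0 rho0 al0 mu_ u0 mv v0 G0 G_nd Hu n x xab.
have Gx0 : 0 <= G (X x) by exact: G0.
apply: (@unroll_affine_inequality _ _ _ _
  (fun k => katugampola_integral mu X a rho (k%:R * alpha) v (X x))
  (fun k => katugampola_integral mu X a rho (k%:R * alpha) u (X x))) => //.
- by move=> k; exact: katugampola_integral_ge0.
- by move=> k; exact: katugampola_integral_ge0.
- by rewrite mul1r; exact: Hu.
move=> k k0; rewrite -natr1 mulrDl mul1r.
apply: (katugampola_integral_gronwall_step (b := b)) => //.
by rewrite mulr_gt0// ltr0n.
Qed.

(** * Estimates of the remainder and of the iterates *)

Lemma powR_invl (R : realType) (x y : R) : 0 <= x -> x^-1 `^ y = x `^ (- y).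
Proof. by move=> x0; rewrite -powR_inv1// -powRrM mulN1r. Qed.

(** [Gamma_lower_bound] with N^alpha = 2 c + 1 gives
    Gamma(alpha n + beta) >= K (2 c + 1)^n, and c / (2 c + 1) <= 1/2. *)
Lemma Gamma_growth (R : realType) (alpha beta c : R) :
  0 < alpha -> 0 <= beta -> 0 <= c ->
  exists2 C, 0 <= C & forall n : nat, 0 < alpha * n%:R + beta ->
    c ^+ n / Gamma (alpha * n%:R + beta) <= C / 2 ^+ n.
Proof.
move=> al0 be0 c0.
pose m : R := 2 * c + 1.
have m0 : 0 < m by rewrite /m; lra.
pose N : R := m `^ alpha^-1.
have N0 : 0 < N by exact: powR_gt0.
have N10 : 0 < N + 1 by rewrite addr_gt0.
pose K : R := N `^ beta * expR (- (N + 1)) / (N + 1).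
have K0 : 0 < K by rewrite divr_gt0// mulr_gt0 ?powR_gt0 ?expR_gt0.
exists K^-1; first by rewrite invr_ge0 ltW.
move=> n nab; have := Gamma_lower_bound nab N0.
have -> : N `^ (alpha * n%:R + beta) = m ^+ n * N `^ beta.
  rewrite powRD; last by rewrite (gt_eqF N0) implybT.
  have -> : N `^ (alpha * n%:R) = (N `^ alpha) `^ n%:R by rewrite powRrM.
  have -> : N `^ alpha = m.
    by rewrite /N -powRrM mulVf ?gt_eqF// powRr1// ltW.
  by rewrite powR_mulrn// ltW.
have -> : m ^+ n * N `^ beta * expR (- (N + 1)) / (N + 1) = m ^+ n * K.
  by rewrite /K !mulrA.
move=> Gge.
have G0 : 0 < Gamma (alpha * n%:R + beta) by exact: Gamma_gt0.
rewrite ler_pdivrMr// mulrAC ler_pdivlMr ?exprn_gt0// mulrC -exprMn.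
apply: (@le_trans _ _ (m ^+ n)).
  by rewrite lerXn2r ?nnegrE ?mulr_ge0// ?(ltW m0)// /m lerDl.
by rewrite mulrC ler_pdivlMr.
Qed.

(** From order 1 on, the kernel is bounded. *)
Lemma katugampola_integral_le_integral d (T : measurableType d) (R : realType)
    (mu : {measure set T -> \bar R}) (X : T -> R)
    (a rho beta t : R) (phi : T -> \bar R) :
  measurable_fun setT X -> 0 < a -> 0 < rho -> 1 <= beta ->
  measurable_fun setT phi -> (forall x, 0 <= phi x)%E ->
  (katugampola_integral mu X a rho beta phi t <=
   (rho `^ (1 - beta) / Gamma beta * (t `^ rho / a) *
     (t `^ rho) `^ (beta - 1))%:E * \int[mu]_x phi x)%E.
Proof.
move=> mX a0 rho0 be1 mphi phi0.
set c := (X in X%:E).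
have c0 : 0 <= c.
  by rewrite !mulr_ge0 ?powR_ge0 ?invr_ge0 ?Gamma_ge0// ltW.
rewrite -ge0_integralZl_EFin//; apply: ge0_le_integral => //=.
- by move=> x _; rewrite mule_ge0 ?lee_fin ?katugampola_kernel_ge0.
- apply: emeasurable_funM => //.
  by apply/measurable_EFinP; exact: measurable_katugampola_kernel.
- exact: emeasurable_funM.
move=> x _; apply: lee_wpmul2r => //; rewrite lee_fin /katugampola_kernel.
case: ifPn => // /andP[ar rt].
have r0 : 0 < X x by exact: lt_le_trans ar.
have rt' : X x `^ rho <= t `^ rho.
  apply: (ge0_ler_powR (ltW rho0)) => //; rewrite nnegrE; first exact: ltW.
  exact/ltW/(lt_le_trans r0).
have K0 : 0 <= rho `^ (1 - beta) / Gamma beta.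
  by rewrite mulr_ge0 ?powR_ge0 ?invr_ge0 ?Gamma_ge0.
apply: ler_pM; [by rewrite mulr_ge0 ?powR_ge0|exact: powR_ge0| |].
  apply: ler_wpM2l => //.
  rewrite powRB; last by rewrite (gt_eqF r0) implybT.
  rewrite powRr1 ?(ltW r0)//; apply: ler_pM; rewrite ?powR_ge0 ?invr_ge0 ?(ltW r0)//.
  by rewrite lef_pV2 ?posrE.
have b0 : 0 <= beta - 1 by rewrite subr_ge0.
apply: (ge0_ler_powR b0); rewrite ?nnegrE ?subr_ge0 ?powR_ge0//.
by rewrite gerBl powR_ge0.
Qed.

(** By [katugampola_integral_le_integral] and [Gamma_growth], the term of
    index n is at most D / 2^n once n alpha >= 1. *)
Lemma katugampola_integral_remainder d (T : measurableType d) (R : realType)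
    (mu : {measure set T -> \bar R}) (X : T -> R)
    (a rho alpha t g : R) (phi : T -> \bar R) (e : R) :
  measurable_fun setT X -> 0 < a -> 0 < rho -> 0 < alpha -> a <= t -> 0 <= g ->
  measurable_fun setT phi -> (forall x, 0 <= phi x)%E ->
  (\int[mu]_x phi x < +oo)%E -> 0 < e ->
  exists n, ((g ^+ n.+1)%:E *
    katugampola_integral mu X a rho (n.+1%:R * alpha) phi t <= e%:E)%E.
Proof.
move=> mX a0 rho0 al0 at_ g0 mphi phi0 iphi e0.
have t0 : 0 < t by exact: lt_le_trans at_.
have tr0 : 0 < t `^ rho by exact: powR_gt0.
pose L := fine (\int[mu]_x phi x)%E.
have LE : (\int[mu]_x phi x = L%:E)%E.
  by rewrite /L fineK// ge0_fin_numE// integral_ge0.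
have L0 : 0 <= L by rewrite fine_ge0// integral_ge0.
pose c := g * (t `^ rho / rho) `^ alpha.
have c0 : 0 <= c by rewrite mulr_ge0 ?powR_ge0.
have [C C0 HC] := Gamma_growth al0 (lexx 0) c0.
pose D := rho / a * C * L.
have D0 : 0 <= D by rewrite !mulr_ge0 ?invr_ge0 ?(ltW a0) ?(ltW rho0).
have bound n : 1 <= n%:R * alpha ->
    ((g ^+ n)%:E * katugampola_integral mu X a rho (n%:R * alpha) phi t <=
     (D / 2 ^+ n)%:E)%E.
  move=> n1; have nal0 : 0 < n%:R * alpha by exact: lt_le_trans n1.
  apply: le_trans.
    by apply: lee_wpmul2l; [rewrite lee_fin exprn_ge0|
      exact: katugampola_integral_le_integral].
  rewrite LE -!EFinM lee_fin.
  have -> : g ^+ n * (rho `^ (1 - n%:R * alpha) / Gamma (n%:R * alpha) *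
     (t `^ rho / a) * (t `^ rho) `^ (n%:R * alpha - 1) * L) =
     rho / a * (c ^+ n / Gamma (n%:R * alpha)) * L.
    have cE : c ^+ n = g ^+ n * ((t `^ rho) `^ (n%:R * alpha) * rho `^ (- (n%:R * alpha))).
      rewrite /c exprMn; congr (_ * _).
      rewrite -powR_mulrn ?powR_ge0// -powRrM [alpha * _]mulrC powRM ?invr_ge0 ?(ltW rho0) ?powR_ge0//.
      by rewrite powR_invl ?(ltW rho0).
    rewrite cE powRB; last by rewrite (gt_eqF rho0) implybT.
    rewrite powRr1 ?(ltW rho0)// powRN.
    rewrite [(t `^ rho) `^ (_ - 1)]powRB; last by rewrite (gt_eqF tr0) implybT.
    rewrite [(t `^ rho) `^ 1]powRr1 ?(ltW tr0)//.
    have G0 : Gamma (n%:R * alpha) != 0 by rewrite gt_eqF// Gamma_gt0.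
    have p0 : rho `^ (n%:R * alpha) != 0 by rewrite gt_eqF// powR_gt0.
    move: G0 p0 (lt0r_neq0 tr0) (lt0r_neq0 a0).
    move: (Gamma _) (rho `^ _) (t `^ rho) ((t `^ rho) `^ _) (g ^+ n).
    by move=> A B F E H A0 B0 F0 a0'; field; rewrite F0 A0 B0 a0'.
  rewrite /D -[leRHS]mulrA -[X in _ <= X]mulrA.
  have := HC n; rewrite addr0 [alpha * _]mulrC => /(_ nal0) h.
  rewrite [L / _]mulrC [C * _]mulrA -![leLHS]mulrA.
  rewrite !mulrA ler_wpM2r// -!mulrA ler_wpM2l ?(ltW rho0)// ler_wpM2l ?invr_ge0 ?(ltW a0)//.
have cv : (D * 2^-1 ^+ n @[n --> \oo] --> 0).
  by apply: cvg_geometric; rewrite ger0_norm// invf_lt1// ltr1n.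
near \oo => n; exists n; apply: le_trans.
  apply: bound; rewrite -ler_pdivrMr//; apply: (@le_trans _ _ n%:R).
    by near: n; exact: nbhs_infty_ger.
  by rewrite ler_nat.
rewrite lee_fin; apply: (@le_trans _ _ (D * 2^-1 ^+ n)).
  rewrite exprVn ler_wpM2l// lef_pV2 ?posrE ?exprn_gt0//.
  by rewrite ler_weXn2l// ler1n.
near: n; have := cv; move=> /cvgr0Pnorm_le /(_ _ e0); apply: filterS => n.
exact: le_trans (ler_norm _).
Unshelve. all: by end_near. Qed.

(** J beta 1 is itself a composition of kernels: as a function of r >= a, the
    kernel of order 1 at (r, a) is the constant a^(rho-1), so the composition
    with it bounds J beta 1 by a kernel of order beta + 1. *)
Lemma katugampola_integral_le_cst d (T : measurableType d) (R : realType)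
    (mu : {measure set T -> \bar R}) (X : T -> R)
    (a rho beta t V : R) (phi : T -> \bar R) :
  measurable_fun setT X ->
  transports_to_lebesgue mu X ->
  0 < a -> 0 < rho -> 0 < beta -> a <= t -> 0 <= V ->
  measurable_fun setT phi -> (forall x, 0 <= phi x)%E ->
  (forall x, (a <= X x <= t)%R -> phi x <= V%:E)%E ->
  (katugampola_integral mu X a rho beta phi t <=
    (V * (((t `^ rho - a `^ rho) / rho) `^ beta / Gamma (beta + 1)))%:E)%E.
Proof.
move=> mX pX a0 rho0 be0 at_ V0 mphi phi0 phiV.
have q0 : 0 < a `^ (rho - 1) by exact: powR_gt0.
pose h r := katugampola_kernel a rho beta t r * katugampola_kernel a rho 1 r a.
have h0 r : 0 <= h r by rewrite mulr_ge0 ?katugampola_kernel_ge0.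
have mh : measurable_fun setT (h : measurableTypeR R -> R).
  by apply: measurable_funM; exact: measurable_katugampola_kernel.
have Vq0 : 0 <= V / a `^ (rho - 1) by rewrite divr_ge0// ltW.
apply: (@le_trans _ _ (\int[mu]_x ((V / a `^ (rho - 1))%:E * (h (X x))%:E))%E).
  apply: ge0_le_integral => //=.
  - by move=> x _; rewrite mule_ge0 ?lee_fin ?katugampola_kernel_ge0.
  - apply: emeasurable_funM => //.
    by apply/measurable_EFinP; exact: measurable_katugampola_kernel.
  - apply: emeasurable_funM => //; apply/measurable_EFinP.
    exact: (measurableT_comp mh mX).
  - move=> x _; rewrite /h /katugampola_kernel lexx/=.
    case: ifPn => [/andP[ar rt]|_]; last by rewrite mul0e mul0r mule0.
    rewrite ar subrr !powRr0 Gamma1 divr1 mulr1 mul1r -EFinM.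
    set K := _ * (_ `^ (beta - 1)).
    have K0 : 0 <= K by rewrite /K !mulr_ge0 ?powR_ge0 ?invr_ge0 ?Gamma_ge0.
    rewrite mulrCA [_ / _ * _]divfK ?gt_eqF// [in leRHS]EFinM.
        by apply: lee_wpmul2l; rewrite ?lee_fin//; apply: phiV; rewrite ar rt.
rewrite ge0_integralZl_EFin//=; last 2 first.
- by move=> x _; rewrite lee_fin.
- by apply/measurable_EFinP; exact: (measurableT_comp mh mX).
rewrite pX//; apply: le_trans.
  apply: lee_wpmul2l; first by rewrite lee_fin.
  exact: katugampola_kernel_comp.
rewrite -EFinM lee_fin /katugampola_kernel lexx at_/= addrK.
have -> : 1 - (beta + 1) = - beta by ring.
have D0 : 0 <= t `^ rho - a `^ rho.
  rewrite subr_ge0; apply: (ge0_ler_powR (ltW rho0)) => //.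
    by rewrite nnegrE ltW.
  by rewrite nnegrE (le_trans (ltW a0)).
rewrite powRM ?invr_ge0 ?(ltW rho0)//.
rewrite powR_invl ?(ltW rho0)//.
have G0 : Gamma (beta + 1) != 0 by rewrite gt_eqF// Gamma_gt0// addr_gt0.
move: G0 (lt0r_neq0 q0); move: (a `^ (rho - 1)) (Gamma _) (rho `^ _) (_ `^ beta).
move=> A B C D B0 A0; rewrite le_eqVlt; apply/orP; left; apply/eqP.
by field; rewrite A0 B0.
Qed.

(** * The completed Lebesgue measure *)

(** The reals with the completed Lebesgue sigma-algebra, under a name of their
    own: on R itself the Borel structure would be inferred. *)
Definition completedTypeR (R : realType) : Type :=
  caratheodory_type ((wlength (@idfun R))^*)%mu.
HB.instance Definition _ (R : realType) := Measurable.on (completedTypeR R).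

Definition of_completed {R : realType} (x : completedTypeR R) : R := x.

Lemma measurable_of_completed (R : realType) :
  measurable_fun [set: completedTypeR R] (@of_completed R).
Proof.
move=> _ A mA; rewrite setTI.
exact: (@sub_caratheodory _ _ _ (wlength (@idfun R))).
Qed.

Lemma of_completed_transports_to_lebesgue (R : realType) :
  transports_to_lebesgue (@completed_lebesgue_measure R) (@of_completed R).
Proof.
move=> h mh h0.
have := @ge0_integral_pushforward _ _ (completedTypeR R) (measurableTypeR R) R
  of_completed (@measurable_of_completed R) (@completed_lebesgue_measure R)
  setT (EFin \o h) measurableT _ _.
rewrite preimage_setT => <-; last 2 first.
- exact/measurable_EFinP.
- by move=> y _; rewrite lee_fin.
by apply: eq_measure_integral; first exact: measurable_of_completed.
Qed.

Lemma measurable_completed_itv (R : realType) (i : interval R) :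
  measurable ([set` i] : set (completedTypeR R)).
Proof.
have := @measurable_of_completed R measurableT [set` i] (measurable_itv i).
by rewrite setTI.
Qed.

(** Nothing is known of u and v outside [a, b], while Tonelli wants functions
    that are measurable and nonnegative everywhere. *)
Definition zero_extension (R : realType) (a b : R) (f : R -> R)
  (x : completedTypeR R) : \bar R := ((f \_ `[a, b]) (of_completed x))%:E.

Lemma zero_extensionE (R : realType) (a b t : R) (f : R -> R) :
  t \in `[a, b] -> zero_extension a b f t = (f t)%:E.
Proof. by move=> tab; rewrite /zero_extension patchE mem_set. Qed.

Lemma zero_extension_ge0 (R : realType) (a b : R) (f : R -> R) x :
  (forall t, t \in `[a, b] -> 0 <= f t) -> (0 <= zero_extension a b f x)%E.
Proof.
move=> f0; rewrite /zero_extension lee_fin patchE.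
by case: ifPn => // /set_mem; exact: f0.
Qed.

Lemma measurable_Lintegrable (R : realType) (a b : R) (f : R -> R) :
  Lintegrable `[a, b] f ->
  @measurable_fun _ _ (completedTypeR R) R `[a, b] f.
Proof. by move=> /integrableP[/measurable_EFinP]. Qed.

Lemma measurable_zero_extension (R : realType) (a b : R) (f : R -> R) :
  Lintegrable `[a, b] f -> measurable_fun setT (zero_extension a b f).
Proof.
move=> /measurable_Lintegrable mf; apply/measurable_EFinP.
exact/(measurable_restrictT (f : completedTypeR R -> R)
  (measurable_completed_itv _)).
Qed.

Lemma integral_zero_extension_lty (R : realType) (a b : R) (f : R -> R) :
  Lintegrable `[a, b] f -> (forall t, t \in `[a, b] -> 0 <= f t) ->
  (\int[@completed_lebesgue_measure R]_x zero_extension a b f x < +oo)%E.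
Proof.
move=> /integrableP[_ +] f0; apply: le_lt_trans.
rewrite [leRHS]integral_mkcond le_eqVlt; apply/orP; left; apply/eqP.
apply: eq_integral => x _; rewrite /zero_extension !patchE.
by case: ifPn => // /set_mem xab; rewrite /= ger0_norm// f0.
Qed.
Lemma measurable_katugampola_weight (R : realType) (rho beta t : R) (f : R -> R)
    (D : set (completedTypeR R)) :
  @measurable_fun _ _ (completedTypeR R) R D f ->
  @measurable_fun _ _ (completedTypeR R) R D
    (fun s => s `^ (rho - 1) * (t `^ rho - s `^ rho) `^ (beta - 1) * f s).
Proof.
move=> mf.
have mw : measurable_fun setT (fun s : measurableTypeR R =>
    s `^ (rho - 1) * (t `^ rho - s `^ rho) `^ (beta - 1)).
  have mr : measurable_fun setT (fun s : measurableTypeR R => s `^ rho).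
    exact: measurable_powR.
  apply: measurable_funM; first exact: measurable_powR.
  by apply: (measurableT_comp (measurable_powR _)); exact: measurable_funB.
exact: (measurable_funM (measurable_funTS
  (measurableT_comp mw (@measurable_of_completed R))) mf).
Qed.

Lemma LintegralZl (R : realType) (a t k : R) (w : R -> R) :
  0 <= k -> @measurable_fun _ _ (completedTypeR R) R `[a, t] w ->
  (forall s, s \in `[a, t] -> 0 <= w s) ->
  (Lintegral `[a, t] (fun s => (k * w s)%:E) =
   k%:E * Lintegral `[a, t] (fun s => (w s)%:E))%E.
Proof.
move=> k0 mw w0.
apply: (@ge0_integralZl_EFin _ (completedTypeR R) R completed_lebesgue_measure
  `[a, t]%classic (measurable_completed_itv _) (EFin \o w)) => //.
exact/measurable_EFinP.
Qed.

Lemma katugampola_integralE (R : realType) (a b rho beta t : R) (f : R -> R) :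
  Lintegrable `[a, b] f -> (forall s, s \in `[a, b] -> 0 <= f s) ->
  t \in `[a, b] ->
  (katugampola_integral (@completed_lebesgue_measure R) of_completed
     a rho beta (zero_extension a b f) t =
   (rho `^ (1 - beta) / Gamma beta)%:E *
   Lintegral `[a, t] (fun s =>
     (s `^ (rho - 1) * (t `^ rho - s `^ rho) `^ (beta - 1) * f s)%:E))%E.
Proof.
move=> fint f0; rewrite in_itv/= => /andP[at_ tb].
have sub s : s \in `[a, t] -> s \in `[a, b].
  by rewrite !in_itv/= => /andP[-> /le_trans ->].
rewrite -LintegralZl; last 3 first.
- by rewrite mulr_ge0 ?powR_ge0 ?invr_ge0 ?Gamma_ge0.
- apply: measurable_katugampola_weight.
  apply: measurable_funS (measurable_Lintegrable fint).
    exact: measurable_completed_itv.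
  by move=> s /sub.
- by move=> s /sub/f0 fs0; rewrite !mulr_ge0 ?powR_ge0.
rewrite /Lintegral.
rewrite [RHS]integral_mkcond; apply: eq_integral => s _.
rewrite patchE /katugampola_kernel; case: ifPn => [/andP[as_ st]|/negP sat].
  have sI : s \in `[a, t] by rewrite in_itv/= as_ st.
  by rewrite mem_set// zero_extensionE ?sub// -!EFinM !mulrA.
rewrite mul0e memNset//= in_itv/=; exact/negP.
Qed.

Lemma sum_integral_le_integral_series d (T : measurableType d) (R : realType)
    (mu : {measure set T -> \bar R}) (D : set T) (h : nat -> T -> \bar R) n :
  measurable D -> (forall k, measurable_fun D (h k)) ->
  (forall k x, D x -> 0 <= h k x)%E ->
  (\sum_(1 <= k < n) \int[mu]_(x in D) h k x <=
   \int[mu]_(x in D) \sum_(1 <= k <oo) h k x)%E.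
Proof.
move=> mD mh h0; rewrite -ge0_integral_sum//; apply: ge0_le_integral => //.
- by move=> x Dx; apply: sume_ge0 => k _; exact: h0.
- exact: emeasurable_sum.
- apply: (emeasurable_fun_cvg (fun m x => \sum_(1 <= k < m) h k x)%E).
    by move=> m; exact: emeasurable_sum.
  by move=> x Dx; apply: is_cvg_nneseries => k _ _; exact: h0.
- by move=> x Dx; apply: nneseries_lim_ge => k _ _; exact: h0.
Qed.

(** * The generalized Gronwall inequality *)

Theorem theorem8 (R : realType) (a b alpha rho : R) (u v g : R -> R)
  (a_gt0 : 0 < a) (a_lt_b : a < b) (alpha_gt0 : 0 < alpha) (rho_gt0 : 0 < rho)
  (u_int : Lintegrable `[a, b] u) (v_int : Lintegrable `[a, b] v)
  (g_cont : {within `[a, b], continuous g})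
  (u_ge0 : forall t, t \in `[a, b] -> 0 <= u t)
  (v_ge0 : forall t, t \in `[a, b] -> 0 <= v t)
  (g_ge0 : forall t, t \in `[a, b] -> 0 <= g t)
  (g_nd : {in `[a, b] &, nondecreasing_fun g})
  (u_le : forall t, t \in `[a, b] ->
    ((u t)%:E <= (v t)%:E + (g t * rho `^ (1 - alpha))%:E *
       Lintegral `[a, t] (fun s =>
         (s `^ (rho - 1) * (t `^ rho - s `^ rho) `^ (alpha - 1) * u s)%:E))%E) :
  (forall t, t \in `[a, b] ->
    ((u t)%:E <= (v t)%:E +
       Lintegral `[a, t] (fun s => \sum_(1 <= k <oo)
         (rho `^ (1 - k%:R * alpha) * (g t * Gamma alpha) ^+ k
            / Gamma (k%:R * alpha)
          * s `^ (rho - 1) * (t `^ rho - s `^ rho) `^ (k%:R * alpha - 1)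
          * v s)%:E))%E)
  /\
  ({in `[a, b] &, nondecreasing_fun v} -> forall t, t \in `[a, b] ->
    u t <= v t * mittag_leffler alpha
             (g t * Gamma alpha * ((t `^ rho - a `^ rho) / rho) `^ alpha)).
Proof.
pose X := @of_completed R; pose mX := @measurable_of_completed R.
pose cmu := @completed_lebesgue_measure R.
pose G t := g t * Gamma alpha.
pose U := zero_extension a b u; pose V := zero_extension a b v.
pose J beta := katugampola_integral cmu X a rho beta.
have Ga0 : 0 < Gamma alpha by exact: Gamma_gt0.
have G0 t : t \in `[a, b] -> 0 <= G t.
  by move=> tab; rewrite mulr_ge0 ?g_ge0// ltW.
have U0 x : (0 <= U x)%E by exact: zero_extension_ge0.
have V0 x : (0 <= V x)%E by exact: zero_extension_ge0.
have mU : measurable_fun setT U by exact: measurable_zero_extension.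
have mV : measurable_fun setT V by exact: measurable_zero_extension.
have HU x : (a <= X x <= b)%R ->
    (U x <= V x + (G (X x))%:E * J alpha U (X x))%E.
  move=> xab; have xI : X x \in `[a, b] by rewrite in_itv.
  rewrite /U /V !zero_extensionE// /J katugampola_integralE//.
  rewrite muleA -EFinM (_ : G (X x) * _ = g (X x) * rho `^ (1 - alpha)).
    exact: u_le.
  by rewrite /G; field; rewrite gt_eqF.
have iter n t : t \in `[a, b] ->
    ((u t)%:E <= (v t)%:E +
      \sum_(1 <= k < n.+1) (G t ^+ k)%:E * J (k%:R * alpha)%R V t +
      (G t ^+ n.+1)%:E * J (n.+1%:R * alpha)%R U t)%E.
  move=> tI; rewrite -(zero_extensionE u tI) -(zero_extensionE v tI).
  apply: (@katugampola_integral_gronwall_iter _ _ _ cmu X a b rho alpha U V G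
    mX (@of_completed_transports_to_lebesgue R) _ _ _ _ _ _ _ _ _ HU n t) => //.
  by move=> r s rI sI rs; rewrite ler_wpM2r ?(ltW Ga0)//; exact: g_nd.
have rem t e : t \in `[a, b] -> 0 < e ->
    exists n, ((G t ^+ n.+1)%:E * J (n.+1%:R * alpha)%R U t <= e%:E)%E.
  move=> tI e0; apply: katugampola_integral_remainder => //.
  - by move: tI; rewrite in_itv/= => /andP[].
  - exact: G0.
  - exact: integral_zero_extension_lty.
split => [t tI|v_nd t tI].
  apply/lee_addgt0Pr => e e0; have [n ne] := rem t e tI e0.
  apply: (le_trans (iter n t tI)); apply: leeD => //; apply: leeD2l.
  pose w k s := s `^ (rho - 1) * (t `^ rho - s `^ rho) `^ (k%:R * alpha - 1) * v s.
  pose p k := rho `^ (1 - k%:R * alpha) * G t ^+ k / Gamma (k%:R * alpha).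
  have sub s : s \in `[a, t] -> s \in `[a, b].
    by move: tI; rewrite !in_itv/= => /andP[_ tb] /andP[-> /le_trans ->].
  have w0 k s : s \in `[a, t] -> 0 <= w k s.
    by move=> /sub/v_ge0 vs0; rewrite !mulr_ge0 ?powR_ge0.
  have p0 k : 0 <= p k.
    by rewrite !mulr_ge0 ?powR_ge0 ?invr_ge0 ?Gamma_ge0 ?exprn_ge0// G0.
  have mw k : @measurable_fun _ _ (completedTypeR R) R `[a, t] (w k).
    apply: measurable_katugampola_weight.
    apply: measurable_funS (measurable_Lintegrable v_int).
      exact: measurable_completed_itv.
    by move=> s /sub.
  have -> : Lintegral `[a, t] (fun s => \sum_(1 <= k <oo)
         (rho `^ (1 - k%:R * alpha) * (g t * Gamma alpha) ^+ k
            / Gamma (k%:R * alpha)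
          * s `^ (rho - 1) * (t `^ rho - s `^ rho) `^ (k%:R * alpha - 1)
          * v s)%:E)%E =
      Lintegral `[a, t] (fun s => \sum_(1 <= k <oo) (p k * w k s)%:E)%E.
    apply: eq_integral => s _; apply: eq_eseriesr => k _.
    by rewrite /p /w !mulrA.
  apply: le_trans (@sum_integral_le_integral_series _ (completedTypeR R) R
    cmu `[a, t] (fun k s => (p k * w k s)%:E) n.+1 _ _ _).
  - apply: lee_sum => k _; rewrite le_eqVlt; apply/orP; left; apply/eqP.
    rewrite /J katugampola_integralE// muleA -EFinM.
    have -> : G t ^+ k * (rho `^ (1 - k%:R * alpha) / Gamma (k%:R * alpha)) = p k.
      by rewrite mulrCA mulrA.
    by rewrite -(LintegralZl (p0 k) (mw k) (w0 k)).
  - exact: measurable_completed_itv.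
  - move=> k; apply/measurable_EFinP; apply: measurable_funM => //; exact: mw.
  - by move=> k s sI; rewrite lee_fin mulr_ge0// w0.
have at_ : a <= t by move: tI; rewrite in_itv/= => /andP[].
pose c := g t * Gamma alpha * ((t `^ rho - a `^ rho) / rho) `^ alpha.
pose ml := fun k : nat => c ^+ k / Gamma (alpha * k%:R + 1).
have c0 : 0 <= c by rewrite mulr_ge0 ?powR_ge0//; exact: G0.
have ml0 k : 0 <= ml k by rewrite divr_ge0 ?exprn_ge0 ?Gamma_ge0.
have ml_cvg : cvgn (series ml).
  have [C C0 HC] := Gamma_growth alpha_gt0 ler01 c0.
  apply: (series_le_cvg ml0 _ (v_ := fun n => C * 2^-1 ^+ n)).
  - by move=> n; rewrite mulr_ge0// exprn_ge0.
  - move=> n; rewrite exprVn; apply: HC.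
    by rewrite ltr_wpDl// mulr_ge0// ltW.
  - by apply: is_cvg_geometric_series; rewrite ger0_norm// invf_lt1// ltr1n.
have ml_le n : series ml n <= mittag_leffler alpha c.
  by apply: nondecreasing_cvgn_le => //; apply: nondecreasing_series.
apply/ler_addgt0Pr => e e0; have [n ne] := rem t e tI e0.
rewrite -lee_fin; apply: (le_trans (iter n t tI)); rewrite EFinD; apply: leeD => //.
apply: (@le_trans _ _ (v t * series ml n.+1)%:E); last first.
  by rewrite lee_fin ler_wpM2l// v_ge0.
(* The term v t of the estimate is the summand of index 0, as Gamma 1 = 1. *)
have -> : v t * series ml n.+1 = v t + \sum_(1 <= k < n.+1) v t * ml k.
  rewrite /series/= big_nat_recl//= mulrDr big_distrr/= big_add1/=; congr (_ + _).
  by rewrite /ml expr0 mulr0 add0r Gamma1 divr1 mulr1.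
rewrite EFinD leeD2l// -sumEFin; rewrite big_nat [leRHS]big_nat.
apply: lee_sum => k /andP[k0 _].
have kal0 : 0 < k%:R * alpha by rewrite mulr_gt0// ltr0n.
apply: le_trans.
  apply: lee_wpmul2l; first by rewrite lee_fin exprn_ge0// G0.
  apply: (@katugampola_integral_le_cst _ _ _ cmu X a rho (k%:R * alpha) t (v t) V
    mX (@of_completed_transports_to_lebesgue R)) => //; first exact: v_ge0.
  move=> x /andP[ax xt].
  have xI : X x \in `[a, b].
    by move: tI; rewrite !in_itv/= ax => /andP[_]; exact: le_trans.
  by rewrite /V zero_extensionE// lee_fin v_nd.
have cE : c ^+ k = G t ^+ k * ((t `^ rho - a `^ rho) / rho) `^ (k%:R * alpha).
  rewrite /c /G [LHS]exprMn; congr (_ * _).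
  by rewrite [RHS]powRrM [RHS]powRAC powR_mulrn ?powR_ge0.
by rewrite -EFinM lee_fin /ml cE [alpha * _]mulrC mulrCA -!mulrA.
Qed.
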